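(* Let $(G,B,m,w)$ be a weighted finite graph with boundary. Then $\lambda_i\ge\nu_i$ for $i=1,2,\dots,|\Omega|$.
   Context: A weighted finite graph $(G,m,w)$ is a finite simple graph $G$ with vertex set $V$ and edge set $E$, a vertex-measure $m:V\to(0,\infty)$ and an edge-weight $w:E\to(0,\infty)$; $w$ is extended to a symmetric function on $V\times V$ by $w_{xy}=0$ when $\{x,y\}\notin E$. A weighted finite graph with boundary $(G,B,m,w)$ is a weighted finite graph with a nonempty subset $B\subset V$ (the boundary); $\Omega=V\setminus B$ is the interior. $\mathbb{R}^S$ is the space of real functions on $S$, with inner product $\langle u,v\rangle_S=\sum_{x\in S}u(x)v(x)m_x$. Laplacian: $\Delta u(x)=\frac1{m_x}\sum_{y\in V}(u(x)-u(y))w_{xy}$ for $u\in\mathbb{R}^V$. Dirichlet Laplacian: for $u\in\mathbb{R}^\Omega$ let $E_0(u)\in\mathbb{R}^V$ be its extension by $0$ on $B$, and $\Delta^Du=(\Delta E_0(u))|_\Omega$. This is a nonnegative self-adjoint operator on $\mathbb{R}^\Omega$ with eigenvalues (the Dirichlet eigenvalues), counted with multiplicity, $0\le\lambda_1\le\dots\le\lambda_{|\Omega|}$. Neumann Laplacian: for $u\in\mathbb{R}^\Omega$, let $N_0(u)\in\mathbb{R}^V$ be the function with $N_0(u)=u$ on $\Omega$, $\Delta N_0(u)=0$ on $B$, and $N_0(u)=0$ on the connected components of $G$ containing no vertex of $\Omega$ (this is unique). Set $\Delta^N u=(\Delta N_0(u))|_\Omega$. This is a nonnegative self-adjoint operator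 on $\mathbb{R}^\Omega$ with eigenvalues (the Neumann eigenvalues), counted with multiplicity, $0\le\nu_1\le\nu_2\le\dots\le\nu_{|\Omega|}$. *)

(* Defs.v *)
From HB Require Import structures.
From mathcomp Require Import all_boot all_order all_algebra.
From mathcomp Require Import boolp classical_sets reals complex.
From mathcomp Require Import ring lra.

Set Implicit Arguments.
Unset Strict Implicit.
Unset Printing Implicit Defensive.

Import Order.TTheory GRing.Theory Num.Theory.

Local Open Scope ring_scope.

Record weightedGraph (R : realType) := WeightedGraph {
  vertex :> finType;
  adj : rel vertex;
  adj_sym : symmetric adj;
  adj_irr : irreflexive adj;
  mass : vertex -> R;
  mass_gt0 : forall x, 0 < mass x;
  weight : vertex -> vertex -> R;
  weight_sym : forall x y, weight x y = weight y x;
  weight_gt0 : forall x y, adj x y -> 0 < weight x y;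
  weight_eq0 : forall x y, ~~ adj x y -> weight x y = 0
}.

Notation interior B := {x | x \notin B}.

(* R^S is {ffun S -> R^o}; R^o is R seen as a vector space over itself, which
   gives {ffun S -> R^o} its structure of finite-dimensional vector space. *)

Section InnerProduct.
Context {R : realType} {S : finType} (m : S -> R).
Implicit Types u v : {ffun S -> R^o}.

Definition inner u v : R := \sum_(x : S) u x * v x * m x.

Definition self_adjoint (T : {ffun S -> R^o} -> {ffun S -> R^o}) :=
  forall u v, inner (T u) v = inner u (T v).

End InnerProduct.

Section Laplacian.
Context {R : realType} {G : weightedGraph R}.
Implicit Types f g : {ffun G -> R^o}.

Definition laplacian f : {ffun G -> R^o} :=
  [ffun x => (mass x)^-1 * \sum_(y : G) (f x - f y) * weight x y].

Fact laplacian_linear : linear laplacian.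
Proof.
move=> a f g; apply/ffunP => x; rewrite !ffunE /GRing.scale /=.
rewrite mulrCA -mulrDr [X in _ = _ * (X + _)]mulr_sumr -big_split /=.
congr (_ * _); apply: eq_bigr => y _.
by rewrite !ffunE /GRing.scale /=; ring.
Qed.
HB.instance Definition _ := GRing.isSemilinear.Build R _ _ _ laplacian
  (GRing.semilinear_linear laplacian_linear).

Lemma weight_ge0 (x y : G) : 0 <= weight x y.
Proof.
by case: (boolP (adj x y)) => [/weight_gt0/ltW //|/weight_eq0->].
Qed.

Lemma green f g : inner (@mass R G) (laplacian f) g =
  2^-1 * \sum_x \sum_y (f x - f y) * (g x - g y) * weight x y.
Proof.
pose s := \sum_x \sum_y (f x - f y) * g x * weight x y.
have -> : inner (@mass R G) (laplacian f) g = s.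
  apply: eq_bigr => x _; rewrite ffunE mulrAC mulrAC.
  rewrite [_^-1 * _]mulrC -!mulrA [g x * _]mulrC mulKf ?gt_eqF ?mass_gt0 //.
  by rewrite mulr_suml; apply: eq_bigr => y _; rewrite mulrAC.
have s2 : s = \sum_x \sum_y - ((f x - f y) * g y * weight x y).
  rewrite /s exchange_big /=; apply: eq_bigr => x _; apply: eq_bigr => y _.
  by rewrite weight_sym; ring.
have -> : \sum_x \sum_y (f x - f y) * (g x - g y) * weight x y = s + s.
  rewrite {2}s2 -big_split; apply: eq_bigr => x _; rewrite -big_split.
  by apply: eq_bigr => y _ /=; ring.
by field.
Qed.

Lemma laplacian_sym f g :
  inner (@mass R G) (laplacian f) g = inner (@mass R G) f (laplacian g).
Proof.
have -> : inner (@mass R G) f (laplacian g) = inner (@mass R G) (laplacian g) f.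
  by apply: eq_bigr => x _; rewrite [f x * _]mulrC.
rewrite !green; congr (_ * _); apply: eq_bigr => x _; apply: eq_bigr => y _.
by rewrite [(f x - _) * _]mulrC.
Qed.

Lemma energy_eq0 f : inner (@mass R G) (laplacian f) f = 0 ->
  forall x y, connect (@adj R G) x y -> f x = f y.
Proof.
rewrite green => /eqP; rewrite mulf_eq0 invr_eq0 pnatr_eq0 /=.
have ge0 x y : 0 <= (f x - f y) * (f x - f y) * weight x y.
  by rewrite mulr_ge0 ?weight_ge0 // -expr2 sqr_ge0.
rewrite psumr_eq0 => [/allP s0|x _]; last exact: sumr_ge0.
have f_adj x y : adj x y -> f x = f y.
  move=> xy; have /= := s0 x (mem_index_enum x).
  rewrite psumr_eq0 // => /allP/(_ y (mem_index_enum y))/=.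
  by rewrite !mulf_eq0 (gt_eqF (weight_gt0 xy)) orbF orbb subr_eq0 => /eqP.
move=> x y /connectP[p]; elim: p x => [x _ ->//|z p IHp x /= /andP[xz zp] yE].
by rewrite (f_adj _ _ xz) (IHp z).
Qed.

End Laplacian.

Section Boundary.
Context {R : realType} {G : weightedGraph R} (B : {set G}).
Implicit Types (f g : {ffun G -> R^o}) (u v : {ffun interior B -> R^o}).

Definition restriction f : {ffun interior B -> R^o} := [ffun x => f (val x)].

Definition zero_ext u : {ffun G -> R^o} :=
  [ffun x => if insub x is Some y then u y else 0].

Definition dirichlet_laplacian u := restriction (laplacian (zero_ext u)).

Record is_neumann_ext u f : Prop := IsNeumannExt {
  neumann_ext_int : forall x : interior B, f (val x) = u x;
  neumann_ext_bnd : forall x, x \in B -> laplacian f x = 0;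
  neumann_ext_isolated : forall x,
    (forall y, y \notin B -> ~~ connect (@adj R G) x y) -> f x = 0
}.

(* The unique Neumann extension of u, see neumann_ext_exists and
   neumann_ext_unique. *)
Definition neumann_ext u : {ffun G -> R^o} :=
  xget 0 [set f | is_neumann_ext u f]%classic.

Definition neumann_laplacian u := restriction (laplacian (neumann_ext u)).

Lemma inner_restriction (m : G -> R) f g :
  (forall x, x \in B -> f x * g x = 0) ->
  inner m f g = inner (m \o val) (restriction f) (restriction g).
Proof.
move=> fg0; rewrite /inner (bigID (fun x => x \notin B)) /=.
rewrite [X in _ + X]big1 ?addr0 => [|x]; last first.
  by rewrite negbK => /fg0->; rewrite mul0r.
rewrite (reindex_omap (val : interior B -> G) insub) => [|x xB]; last first.
  by rewrite insubT.
apply: eq_big => [x|x _]; first by rewrite valK eqxx (valP x).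
by rewrite !ffunE.
Qed.

Let is_neumann_ext0 f : is_neumann_ext 0 f -> f = 0.
Proof.
move=> [fi fb fz]; apply/ffunP => x; rewrite ffunE.
have e0 : inner (@mass R G) (laplacian f) f = 0.
  rewrite /inner big1 // => y _; case: (boolP (y \in B)) => [/fb->|yB].
    by rewrite !mul0r.
  by have := fi (Sub y yB); rewrite SubK ffunE => ->; rewrite mulr0 mul0r.
have [[y yB xy]|noy] :=
  pselect (exists2 y, y \notin B & connect (@adj R G) x y).
  rewrite (energy_eq0 e0 xy).
  by have := fi (Sub y yB); rewrite SubK ffunE.
by apply: fz => y yB; apply/negP => xy; apply: noy; exists y.
Qed.

Lemma is_neumann_ext_linear a u v f g : is_neumann_ext u f ->
  is_neumann_ext v g -> is_neumann_ext (a *: u + v) (a *: f + g).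
Proof.
move=> [fi fb fz] [gi gb gz]; split=> x.
- by rewrite !ffunE fi gi.
- by move=> xB; rewrite linearP 2!ffunE fb // gb // scaler0 addr0.
- by move=> xB; rewrite 2!ffunE fz // gz // scaler0 addr0.
Qed.

Lemma neumann_ext_unique u f g :
  is_neumann_ext u f -> is_neumann_ext u g -> f = g.
Proof.
move=> uf ug; have := is_neumann_ext_linear (-1) ug uf.
rewrite !scaleN1r addNr => /is_neumann_ext0/eqP.
by rewrite addrC subr_eq0 => /eqP.
Qed.

Let floating x := [forall y, (y \notin B) ==> ~~ connect (@adj R G) x y].

Let system f : {ffun G -> R^o} :=
  [ffun x => if (x \notin B) || floating x then f x else laplacian f x].

Let system_linear : linear system.
Proof.
move=> a f g; apply/ffunP => x; rewrite [LHS]ffunE linearP !ffunE.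
by case: ifP.
Qed.
HB.instance Definition _ := GRing.isSemilinear.Build R _ _ _ system
  (GRing.semilinear_linear system_linear).

Lemma neumann_ext_exists u : exists f, is_neumann_ext u f.
Proof.
have floatingN x : (forall y, y \notin B -> ~~ connect (@adj R G) x y) ->
    floating x.
  by move=> h; apply/forallP => y; apply/implyP/h.
have system_ext v f : system f = zero_ext v -> is_neumann_ext v f.
  move=> sf.
  have fi (x : interior B) : f (val x) = v x.
    have /ffunP/(_ (val x)) := sf; rewrite !ffunE (valP x) /=.
    by rewrite valK.
  have fz x : x \in B -> floating x -> f x = 0.
    move=> xB xz; have /ffunP/(_ x) := sf; rewrite !ffunE xz orbT.
    by case: insubP => // y; rewrite xB.
  have floatB x : floating x -> x \in B.
    move=> /forallP/(_ x); rewrite connect0 implybF negbK //.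
  split=> // [x xB|x /floatingN xz]; last exact/fz/xz/floatB.
  case: (boolP (floating x)) => xz; last first.
    have /ffunP/(_ x) := sf; rewrite [system f x]ffunE xB (negPf xz) /= => ->.
    by rewrite ffunE; case: insubP => // y; rewrite xB.
  rewrite ffunE big1 ?mulr0 // => y _.
  case: (boolP (adj x y)) => [xy|/weight_eq0->]; last by rewrite mulr0.
  have yz : floating y.
    apply/forallP => z; apply/implyP => zB; apply/negP => yz.
    have /forallP/(_ z) := xz; rewrite zB /= => /negP; apply.
    exact: connect_trans (connect1 xy) yz.
  by rewrite !fz ?floatB // subrr mul0r.
have ker0 : lker (linfun system) == 0%VS.
  apply/lker0P => f g /eqP; rewrite -subr_eq0 -linearB /= lfunE => /eqP sfg.
  apply/eqP; rewrite -subr_eq0; apply/eqP/is_neumann_ext0/system_ext.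
  rewrite sfg; apply/ffunP => x; rewrite !ffunE.
  by case: insub => // y; rewrite ffunE.
exists ((linfun system)^-1%VF (zero_ext u)); apply: system_ext.
by rewrite -[LHS](lfunE system) lker0_lfunVK.
Qed.

Lemma neumann_extP u : is_neumann_ext u (neumann_ext u).
Proof. exact: (@xgetPex _ 0 _ (neumann_ext_exists u)). Qed.

Fact dirichlet_laplacian_linear : linear dirichlet_laplacian.
Proof.
move=> a u v; rewrite /dirichlet_laplacian.
have -> : zero_ext (a *: u + v) = a *: zero_ext u + zero_ext v.
  apply/ffunP => x; rewrite !ffunE; case: insub => [y|]; rewrite ?ffunE //.
  by rewrite scaler0 addr0.
by rewrite linearP; apply/ffunP => x; rewrite !ffunE.
Qed.
HB.instance Definition _ := GRing.isSemilinear.Build R _ _ _ dirichlet_laplacian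
  (GRing.semilinear_linear dirichlet_laplacian_linear).

Fact neumann_laplacian_linear : linear neumann_laplacian.
Proof.
move=> a u v; rewrite /neumann_laplacian.
have -> : neumann_ext (a *: u + v) = a *: neumann_ext u + neumann_ext v.
  apply: neumann_ext_unique (neumann_extP _) _.
  exact: is_neumann_ext_linear (neumann_extP _) (neumann_extP _).
by rewrite linearP; apply/ffunP => x; rewrite !ffunE.
Qed.
HB.instance Definition _ := GRing.isSemilinear.Build R _ _ _ neumann_laplacian
  (GRing.semilinear_linear neumann_laplacian_linear).

Lemma dirichlet_laplacian_sym :
  self_adjoint (@mass R G \o val) dirichlet_laplacian.
Proof.
move=> u v; have E w : restriction (zero_ext w) = w.
  by apply/ffunP => x; rewrite !ffunE valK.
have Z w x : x \in B -> zero_ext w x = 0.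
  by move=> xB; rewrite ffunE; case: insubP => // y; rewrite xB.
rewrite -[in LHS](E v) -[in RHS](E u) -!inner_restriction ?laplacian_sym //.
  by move=> x /Z->; rewrite mul0r.
by move=> x /Z->; rewrite mulr0.
Qed.

Lemma neumann_laplacian_sym :
  self_adjoint (@mass R G \o val) neumann_laplacian.
Proof.
move=> u v; have E w : restriction (neumann_ext w) = w.
  by apply/ffunP => x; rewrite ffunE (neumann_ext_int (neumann_extP w)).
have Z w x : x \in B -> laplacian (neumann_ext w) x = 0.
  exact: (neumann_ext_bnd (neumann_extP w)).
rewrite -[in LHS](E v) -[in RHS](E u) -!inner_restriction ?laplacian_sym //.
  by move=> x /Z->; rewrite mulr0.
by move=> x /Z->; rewrite mul0r.
Qed.

End Boundary.

(* s lists the eigenvalues of T in nondecreasing order, each repeated according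
   to its (geometric) multiplicity. *)
Definition eigenvalues_of (R : realType) (vT : vectType R) (T : 'End(vT))
    (s : seq R) : Prop :=
  sorted <=%R s /\
  forall a : R, count_mem a s = \dim (passmx.leigenspace T a).

Lemma symmetric_diagonalizable (R : realType) n (A : 'M[R]_n) :
  A^T = A -> diagonalizable A.
Proof.
case: n A => [|n] A sA; first by rewrite [A]thinmx0; exact: diagonalizable0.
pose c := real_complex R; pose A' := map_mx c A.
have A'real : A' \is a mxOver Num.real.
  by apply/mxOverP => i j; rewrite mxE complex_real.
have A'herm : A' \is hermsymmx.
  apply: realsym_hermsym => //; apply/is_hermitianmxP.
  by rewrite expr0 scale1r map_mx_id // map_trmx sA.
have /orthomx_spectralP A'E := hermitian_normalmx A'herm.
have /mxOverP dR := hermitian_spectral_diag_real A'herm.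
set P := spectralmx A' in A'E; set d := spectral_diag A' in A'E dR.
have cE i : c (complex.Re (d 0 i)) = d 0 i by exact/RRe_real/dR.
pose rs := undup [seq complex.Re (d 0 i) | i <- enum 'I_n.+1].
apply/diagonalizableP; exists rs; first exact: undup_uniq.
rewrite -(dvdp_map c) -mxminpoly_map rmorph_prod /=.
have Pu : P \in unitmx by exact: spectral_unit.
have -> : map_mx c A = conjmx (invmx P) (diag_mx d).
  by rewrite conjVmx.
rewrite mxminpoly_uconj ?unitmx_inv // mxminpoly_diag.
under [X in _ %| X]eq_bigr => r _ do
  rewrite rmorphB /= map_polyX map_polyC.
rewrite -(big_map c xpredT (fun r => 'X - r%:P)) /rs.
rewrite -undup_map_inj; last exact: fmorph_inj.
suff -> : [seq c x | x <- [seq complex.Re (d 0 i) | i <- enum 'I_n.+1]] =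
  [seq d 0 i | i <- enum 'I_n.+1] by [].
by rewrite -map_comp; apply: eq_map.
Qed.

Section Diagonalizable.
Import passmx.

Lemma dim_vsof (F : fieldType) (vT : vectType F) (e : (\dim {:vT}).-tuple vT)
    (M : 'M[F]_(\dim {:vT})) :
  basis_of {:vT} e -> \dim (vsof e M) = \rank M.
Proof.
move=> eB; pose r i := vecof e (row i (row_base M)).
have sumr (k : 'I_(\rank M) -> F) :
    \sum_i k i *: r i = vecof e ((\row_i k i) *m row_base M).
  rewrite mulmx_sum_row raddf_sum; apply: eq_bigr => i _.
  by rewrite mxE -linearZ_LR.
suff rB : basis_of (vsof e M) [tuple r i | i < \rank M].
  by rewrite -(size_basis rB).
apply/andP; split.
  rewrite eqEsubv; apply/andP; split.
    apply/span_subvP => _ /mapP[i _ ->].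
    by rewrite -rVof_sub // vecofK // -(eq_row_base M) row_sub.
  apply/subvP => u; rewrite -rVof_sub // -(eq_row_base M).
  move=> /submxP[k /(canRL (rVofK eB)) ->].
  rewrite (_ : k = \row_i k 0 i) -?sumr; last by apply/rowP => i; rewrite mxE.
  apply: memv_suml => i _; apply/memvZ/memv_span.
  by apply/mapP; exists i; rewrite ?mem_enum.
apply/freeP => k; under eq_bigr => i _ do rewrite -tnth_nth tnth_mktuple.
rewrite sumr => /eqP; rewrite vecof_eq0 // => /eqP k0 i.
have /row_freeP[C CK] := row_base_free M.
have /(congr1 (mulmx^~ C)) := k0.
by rewrite mul0mx -mulmxA CK mulmx1 => /rowP/(_ i); rewrite !mxE.
Qed.

Lemma diagonalizable_eigenvalues (R : realType) (vT : vectType R)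
    (T : 'End(vT)) (e : (\dim {:vT}).-tuple vT) :
  basis_of {:vT} e -> diagonalizable (mxof e e T) ->
  exists s : (\dim {:vT}).-tuple R, eigenvalues_of T s.
Proof.
move=> eB; set A := mxof e e T => /diagonalizablePeigen[rs urs rsT].
pose E a := \rank (eigenspace A a).
have dimE a : \dim (leigenspace T a) = E a.
  by rewrite (leigenspaceE eB) dim_vsof.
have direct (r : seq R) : uniq r ->
    \rank (\sum_(a <- r) eigenspace A a)%MS = (\sum_(a <- r) E a)%N.
  move=> ur; rewrite (big_nth 0) [RHS](big_nth 0) !big_mkord.
  apply/mxdirectP/mxdirect_sum_eigenspace => i j _ _ rij; apply/val_inj.
  by apply: uniqP rij; rewrite ?inE.
have rsE : (\sum_(a <- rs) E a)%N = \dim {:vT}.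
  by rewrite -direct // rsT mxrank1.
have E0 a : a \notin rs -> E a = 0%N.
  move=> ars; have /direct : uniq (a :: rs) by rewrite /= ars.
  rewrite [X in _ = X]big_cons rsE => rk.
  have := rank_leq_row (\sum_(b <- a :: rs) eigenspace A b)%MS.
  by rewrite rk -{2}[\dim _]add0n leq_add2r leqn0 => /eqP.
pose s := flatten [seq nseq (E a) a | a <- rs].
have sz : size (sort <=%R s) == \dim {:vT}.
  rewrite size_sort size_flatten /shape -map_comp sumnE big_map -rsE.
  by apply/eqP/eq_bigr => a _ /=; rewrite size_nseq.
exists (Tuple sz); split=> [|a]; first exact: sort_sorted le_total _.
rewrite dimE /= count_sort count_flatten -map_comp sumnE big_map.
have [ars|ars] := boolP (a \in rs).
  rewrite (bigD1_seq a) //= count_nseq /= eqxx mul1n big1 ?addn0 // => b ba.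
  by rewrite count_nseq /= (negPf ba).
rewrite E0 // big_seq big1 // => b brs /=; rewrite count_nseq /=.
by case: eqP ars brs => // <- /negPf->.
Qed.

Lemma self_adjoint_eigenvalues (R : realType) (S : finType) (m : S -> R)
    (T : {linear {ffun S -> R^o} -> {ffun S -> R^o}}) :
  (forall x, 0 < m x) -> self_adjoint m T ->
  exists s : #|S|.-tuple R, eigenvalues_of (linfun T) s.
Proof.
move=> m_gt0 Tsym.
pose b x : {ffun S -> R^o} := [ffun y => (y == x)%:R * (Num.sqrt (m x))^-1].
have sm_neq0 x : Num.sqrt (m x) != 0 by rewrite gt_eqF // sqrtr_gt0.
have b_inner x (v : {ffun S -> R^o}) : inner m v (b x) = v x * Num.sqrt (m x).
  rewrite /inner (bigD1 x) //= big1 => [|y /negPf yx]; last first.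
    by rewrite ffunE yx mul0r mulr0 mul0r.
  rewrite ffunE eqxx mul1r addr0 -mulrA; congr (_ * _).
  by rewrite -{2}[m x]sqr_sqrtr ?ltW // expr2 mulKf.
have dimS : \dim {: {ffun S -> R^o}} = #|S|.
  by rewrite dimvf /dim /= muln1.
pose x_ i := enum_val (cast_ord dimS i).
pose n := \dim {: {ffun S -> R^o}}.
have [e e_nth] : exists e : n.-tuple {ffun S -> R^o},
    forall i : 'I_n, e`_i = b (x_ i).
  exists [tuple b (x_ i) | i < n] => i.
  by rewrite -tnth_nth tnth_mktuple.
have x_inj : injective x_ by move=> i j /enum_val_inj/cast_ord_inj.
have sum_e (k : 'I_n -> R) i :
    (\sum_j k j *: e`_j) (x_ i) * Num.sqrt (m (x_ i)) = k i.
  rewrite sum_ffunE; under eq_bigr => j _ do rewrite e_nth.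
  rewrite (bigD1 i) //= big1 => [|j ji].
    rewrite !ffunE eqxx mul1r addr0.
    by rewrite /GRing.scale /= mulfVK.
  rewrite !ffunE (inj_eq x_inj) eq_sym (negPf ji).
  by rewrite mul0r scaler0.
have eB : basis_of {: {ffun S -> R^o}} e.
  rewrite basisEfree subvf size_tuple leqnn !andbT.
  apply/freeP => k k0 i; rewrite -[LHS](sum_e k i).
  by rewrite k0 ffunE mul0r.
have coordE i v : coord e i v = inner m v (b (x_ i)).
  rewrite b_inner {2}(coord_basis eB (memvf v)).
  by rewrite (sum_e (fun j => coord e j v)).
rewrite -dimS; apply: (diagonalizable_eigenvalues eB).
apply: symmetric_diagonalizable; apply/matrixP => i j; rewrite !mxE /=.
rewrite !vecof_delta !lfunE /= !coordE !e_nth Tsym.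
by rewrite /inner; apply: eq_bigr => x _; rewrite [b _ x * _]mulrC.
Qed.

End Diagonalizable.

Lemma dirichlet_eigenvalues_exist (R : realType) (G : weightedGraph R)
    (B : {set G}) :
  exists s : #|{: interior B}|.-tuple R,
    eigenvalues_of (linfun (@dirichlet_laplacian R G B)) s.
Proof.
apply: self_adjoint_eigenvalues (@dirichlet_laplacian_sym R G B) => x.
exact: mass_gt0.
Qed.

Lemma neumann_eigenvalues_exist (R : realType) (G : weightedGraph R)
    (B : {set G}) :
  exists s : #|{: interior B}|.-tuple R,
    eigenvalues_of (linfun (@neumann_laplacian R G B)) s.
Proof.
apply: self_adjoint_eigenvalues (@neumann_laplacian_sym R G B) => x.
exact: mass_gt0.
Qed.

(* Main.v *)
(** Both Laplacians are self-adjoint for the same inner product, so by the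
    Courant-Fischer dimension count it suffices to compare their quadratic
    forms.  Those are the energies of the zero extension and of the Neumann
    extension of u.  The two extensions differ by a function g supported on B,
    where the Laplacian of the Neumann extension vanishes; by Green's formula
    the cross term is zero, and the energies differ by the energy of g, which
    is nonnegative. *)

Require Import Defs.
From HB Require Import structures.
From mathcomp Require Import all_boot all_order all_algebra reals.

Set Implicit Arguments.
Unset Strict Implicit.
Unset Printing Implicit Defensive.

Local Open Scope ring_scope.

Import Order.TTheory GRing.Theory Num.Theory.

Section InnerProductTheory.
Context {R : realType} {S : finType} (m : S -> R).
Implicit Types u v w : {ffun S -> R^o}.

Lemma innerC u v : inner m u v = inner m v u.
Proof. by apply: eq_bigr => x _; rewrite [u x * _]mulrC. Qed.

Lemma innerDl u v w : inner m (u + v) w = inner m u w + inner m v w.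
Proof.
by rewrite -big_split; apply: eq_bigr => x _; rewrite ffunE !mulrDl.
Qed.

Lemma innerDr u v w : inner m w (u + v) = inner m w u + inner m w v.
Proof. by rewrite innerC innerDl !(innerC w). Qed.

Lemma innerZl a u v : inner m (a *: u) v = a * inner m u v.
Proof.
by rewrite mulr_sumr; apply: eq_bigr => x _; rewrite ffunE -!mulrA.
Qed.

Lemma innerZr a u v : inner m u (a *: v) = a * inner m u v.
Proof. by rewrite innerC innerZl innerC. Qed.

Hypothesis m_gt0 : forall x, 0 < m x.

Lemma inner_ge0 u : 0 <= inner m u u.
Proof.
by apply: sumr_ge0 => x _; rewrite mulr_ge0 ?(ltW (m_gt0 x)) // -expr2 sqr_ge0.
Qed.

Lemma inner_eq0 u : (inner m u u == 0) = (u == 0).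
Proof.
have ge0 x : 0 <= u x * u x * m x.
  by rewrite mulr_ge0 ?(ltW (m_gt0 x)) // -expr2 sqr_ge0.
apply/idP/eqP => [|->]; last first.
  by rewrite /inner big1 // => x _; rewrite ffunE !mul0r.
rewrite psumr_eq0 // => /allP u0; apply/ffunP => x; rewrite ffunE.
have := u0 x (mem_index_enum x).
by rewrite /= !mulf_eq0 (gt_eqF (m_gt0 x)) orbF orbb => /eqP.
Qed.

End InnerProductTheory.

Section SortedTuples.
Context {R : realType}.

(** Filtering by [p] keeps every copy of a value or none, so multiplicities can be read off in [s]
    itself. This turns sums of eigenspace dimensions into counts of listed eigenvalues. *)
Lemma sum_count_mem_undup (p : pred R) (s : seq R) :
  (\sum_(a <- undup [seq b <- s | p b]) count_mem a s = count p s)%N.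
Proof.
rewrite -size_filter -(perm_size (perm_count_undup (filter p s))).
rewrite size_flatten /shape -map_comp sumnE big_map big_seq [RHS]big_seq.
apply: eq_bigr => a; rewrite mem_undup mem_filter => /andP[pa _] /=.
rewrite size_nseq count_filter; apply: eq_count => b /=.
by case: eqP => [->|].
Qed.

(** The prefix ending at index [i], counted from 0, already supplies [i.+1] such entries. With the
    [n - i] entries of [count_ge_sorted] the total is [n + 1], which forces two subspaces to
    meet. *)
Lemma count_le_sorted n (s : n.-tuple R) (i : 'I_n) :
  sorted <=%R s -> (i < count (fun a => a <= tnth s i)%R s)%N.
Proof.
move=> ss; rewrite -[X in count _ X](cat_take_drop i.+1) count_cat.
apply/(leq_trans _ (leq_addr _ _)).
have sz : size (take i.+1 s) = i.+1 by rewrite size_takel ?size_tuple.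
rewrite -{1}sz leq_eqVlt eq_sym -all_count; apply/orP; left.
apply/(all_nthP 0) => j; rewrite sz => ji; rewrite nth_take // (tnth_nth 0).
apply: (sorted_leq_nth le_trans lexx) => //; rewrite inE size_tuple //.
exact: leq_trans ji _.
Qed.

Lemma count_ge_sorted n (s : n.-tuple R) (i : 'I_n) :
  sorted <=%R s -> (n - i <= count (fun a => tnth s i <= a)%R s)%N.
Proof.
move=> ss; rewrite -[X in count _ X](cat_take_drop i) count_cat.
apply/(leq_trans _ (leq_addl _ _)).
have sz : size (drop i s) = (n - i)%N by rewrite size_drop size_tuple.
rewrite -{1}sz leq_eqVlt eq_sym -all_count; apply/orP; left.
apply/(all_nthP 0) => j; rewrite sz ltn_subRL => ji.
rewrite nth_drop (tnth_nth 0).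
by apply: (sorted_leq_nth le_trans lexx); rewrite ?inE ?size_tuple ?leq_addr.
Qed.

End SortedTuples.

Section CourantFischer.
Context {R : realType} {S : finType} (m : S -> R).
Hypothesis m_gt0 : forall x, 0 < m x.

Local Notation V := {ffun S -> R^o}.
Local Notation eigen T a := (passmx.leigenspace (linfun T) a).

Lemma mem_leigenspace (T : {linear V -> V}) a v :
  (v \in eigen T a) = (T v == a *: v).
Proof.
by rewrite memv_ker add_lfunE opp_lfunE scale_lfunE id_lfunE lfunE subr_eq0.
Qed.

(** Spectral decomposition of [u]: [k a] is the squared norm of its component in the eigenspace of
    [a]. The orthogonality clause strengthens the induction and also shows that the sum of
    eigenspaces is direct. *)
Lemma spectral_weights (T : {linear V -> V}) (r : seq R) (u : V) :
    self_adjoint m T -> uniq r -> u \in (\sum_(a <- r) eigen T a)%VS ->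
  (forall b v, b \notin r -> T v = b *: v -> inner m u v = 0) /\
  exists2 k : R -> R, (forall a, 0 <= k a) &
    inner m u u = \sum_(a <- r) k a /\
    inner m (T u) u = \sum_(a <- r) a * k a.
Proof.
move=> Tsym; elim: r u => [|a r IHr] u /=.
  rewrite big_nil memv0 => _ /eqP->; have in0 v : inner m 0 v = 0.
    by rewrite -(scale0r v) innerZl mul0r.
  split=> [b v _ _|]; first exact: in0.
  by exists (fun=> 0) => //; rewrite !big_nil raddf0 in0.
move=> /andP[ar ur]; rewrite big_cons => /memv_addP[v].
rewrite mem_leigenspace => /eqP Tv [w /(IHr _ ur)[w_orth [k k_ge0 [kE TkE]]] ->].
have vw : inner m v w = 0 by rewrite innerC (w_orth a).
split=> [b z|].
  rewrite inE negb_or => /andP[ba br] Tz.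
  rewrite innerDl (w_orth b) // addr0; apply/eqP.
  (* Self-adjointness gives [(a - b) * inner m v z = 0] with [a] and [b] distinct. *)
  have /eqP : inner m (T v) z = inner m v (T z) by [].
  rewrite Tv Tz innerZl innerZr -subr_eq0 -mulrBl mulf_eq0 subr_eq0.
  by rewrite eq_sym (negPf ba).
(* Since [a] is not in [r], the new weight at [a] leaves the sums over [r] unchanged. *)
exists (fun b => if b == a then inner m v v else k b) => [b|].
  by case: ifP => // _; exact: inner_ge0.
have eq_r b : b \in r -> (b == a) = false.
  by move=> br; apply: contraNF ar => /eqP<-.
have Twv : inner m (T w) v = 0 by rewrite Tsym Tv innerZr innerC vw mulr0.
split.
  rewrite big_cons eqxx !innerDl !innerDr (innerC _ w v) vw.
  by rewrite addr0 add0r kE; congr (_ + _); apply: eq_big_seq => b /eq_r->.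
rewrite big_cons eqxx raddfD /= !innerDl !innerDr Twv Tv !innerZl vw.
rewrite mulr0 addr0 add0r TkE; congr (_ + _).
by apply: eq_big_seq => b /eq_r->.
Qed.

(** A vector lying both in the eigenspace of [a] and in the sum of the others is orthogonal to
    itself, hence zero. *)
Lemma dim_sum_leigenspace (T : {linear V -> V}) (r : seq R) :
    self_adjoint m T -> uniq r ->
  \dim (\sum_(a <- r) eigen T a)%VS = (\sum_(a <- r) \dim (eigen T a))%N.
Proof.
move=> Tsym; elim: r => [|a r IHr] /=; first by rewrite !big_nil dimv0.
move=> /andP[ar ur]; rewrite !big_cons dimv_disjoint_sum ?IHr //.
apply/eqP; rewrite -subv0; apply/subvP => u; rewrite memv_cap memv0.
rewrite mem_leigenspace => /andP[/eqP Tu /(spectral_weights Tsym ur)[orth _]].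
by rewrite -(inner_eq0 m_gt0) (orth a) ?eqxx.
Qed.

Lemma dim_sum_eigenvalues (T : {linear V -> V}) (p : pred R) (s : seq R) :
    self_adjoint m T -> eigenvalues_of (linfun T) s ->
  \dim (\sum_(a <- undup [seq b <- s | p b]) eigen T a)%VS = count p s.
Proof.
move=> Tsym [_ sE]; rewrite dim_sum_leigenspace ?undup_uniq //.
by rewrite -sum_count_mem_undup; apply: eq_bigr.
Qed.

Lemma eigenvalues_le (T1 T2 : {linear V -> V}) (s1 s2 : #|S|.-tuple R) :
    self_adjoint m T1 -> self_adjoint m T2 ->
    (forall u, inner m (T1 u) u <= inner m (T2 u) u) ->
    eigenvalues_of (linfun T1) s1 -> eigenvalues_of (linfun T2) s2 ->
  forall i, tnth s1 i <= tnth s2 i.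
Proof.
move=> sym1 sym2 T12 s1P s2P i; rewrite leNgt; apply/negP => s21.
(* [U] is the upper spectral subspace of [T1] and [W] the lower one of [T2]; [undup] makes each
   eigenspace occur once. *)
pose r1 := undup [seq b <- s1 | tnth s1 i <= b].
pose r2 := undup [seq b <- s2 | b <= tnth s2 i].
set U := (\sum_(a <- r1) eigen T1 a)%VS.
set W := (\sum_(a <- r2) eigen T2 a)%VS.
have dimU : (#|S| - i <= \dim U)%N.
  by rewrite (dim_sum_eigenvalues _ sym1 s1P) count_ge_sorted //; case: s1P.
have dimW : (i < \dim W)%N.
  by rewrite (dim_sum_eigenvalues _ sym2 s2P) count_le_sorted //; case: s2P.
have dimS : \dim {: V} = #|S| by rewrite dimvf /dim /= muln1.
have : (U :&: W != 0)%VS.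
  (* The dimensions of [U] and [W] add up to at least [(#|S| - i) + i.+1], one more than the whole
     space has. *)
  rewrite -dimv_eq0 -lt0n -(ltn_add2l (\dim (U + W))) addn0 dimv_sum_cap.
  apply: leq_ltn_trans (dimvS (subvf _)) _; rewrite dimS.
  apply: leq_trans (leq_add dimU dimW).
  by rewrite addnS subnK // ltnW.
rewrite -vpick0; have := memv_pick (U :&: W); set u := vpick _.
rewrite memv_cap => /andP[uU uW] u0.
have [_ [k1 k1_ge0 [u1 T1u]]] := spectral_weights sym1 (undup_uniq _) uU.
have [_ [k2 k2_ge0 [u2 T2u]]] := spectral_weights sym2 (undup_uniq _) uW.
(* Every eigenvalue in [r1] is at least [tnth s1 i] and the weights are nonnegative; [upper] is
   dual. *)
have lower : tnth s1 i * inner m u u <= inner m (T1 u) u.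
  rewrite T1u u1 mulr_sumr big_seq [leRHS]big_seq; apply: ler_sum => a.
  by rewrite mem_undup mem_filter => /andP[ia _]; rewrite ler_wpM2r.
have upper : inner m (T2 u) u <= tnth s2 i * inner m u u.
  rewrite T2u u2 mulr_sumr big_seq [leRHS]big_seq; apply: ler_sum => a.
  by rewrite mem_undup mem_filter => /andP[ia _]; rewrite ler_wpM2r.
have := le_trans lower (le_trans (T12 u) upper).
(* Dividing by the positive squared norm of [u] contradicts [s21]. *)
rewrite ler_pM2r ?leNgt ?s21 //.
by rewrite lt_neqAle eq_sym (inner_eq0 m_gt0) u0 inner_ge0.
Qed.

End CourantFischer.

Section Energy.
Context {R : realType} {G : weightedGraph R} (B : {set G}).
Implicit Types (f : {ffun G -> R^o}) (u : {ffun interior B -> R^o}).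

Lemma energy_ge0 f : 0 <= inner (@mass R G) (laplacian f) f.
Proof.
rewrite green mulr_ge0 ?invr_ge0 ?ler0n //.
apply: sumr_ge0 => x _; apply: sumr_ge0 => y _.
by rewrite mulr_ge0 ?weight_ge0 // -expr2 sqr_ge0.
Qed.

Lemma zero_ext_bnd u x : x \in B -> zero_ext u x = 0.
Proof. by move=> xB; rewrite ffunE; case: insubP => // y; rewrite xB. Qed.

Lemma zero_ext_int u (x : interior B) : zero_ext u (val x) = u x.
Proof. by rewrite ffunE valK. Qed.

Lemma zero_extK u : restriction B (zero_ext u) = u.
Proof. by apply/ffunP => x; rewrite ffunE zero_ext_int. Qed.

Lemma neumann_extK u : restriction B (neumann_ext u) = u.
Proof.
by apply/ffunP => x; rewrite ffunE (neumann_ext_int (neumann_extP u)).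
Qed.

Lemma dirichlet_form u :
  inner (@mass R G \o val) (dirichlet_laplacian u) u =
  inner (@mass R G) (laplacian (zero_ext u)) (zero_ext u).
Proof.
rewrite (inner_restriction (B := B)) ?zero_extK // => x xB.
by rewrite zero_ext_bnd // mulr0.
Qed.

(** The boundary terms vanish through the Laplacian factor, whereas in [dirichlet_form] they vanish
    through the zero extension itself. *)
Lemma neumann_form u :
  inner (@mass R G \o val) (neumann_laplacian u) u =
  inner (@mass R G) (laplacian (neumann_ext u)) (neumann_ext u).
Proof.
rewrite (inner_restriction (B := B)) ?neumann_extK // => x xB.
by rewrite (neumann_ext_bnd (neumann_extP u)) // mul0r.
Qed.

Lemma neumann_form_le u :
  inner (@mass R G \o val) (neumann_laplacian u) u <=
  inner (@mass R G \o val) (dirichlet_laplacian u) u.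
Proof.
rewrite dirichlet_form neumann_form; set f := neumann_ext u.
have [g fg] : exists g, zero_ext u = f + g.
  by exists (zero_ext u - f); rewrite addrC subrK.
have cross : inner (@mass R G) (laplacian f) g = 0.
  rewrite /inner big1 // => x _; have [xB|xB] := boolP (x \in B).
    by rewrite (neumann_ext_bnd (neumann_extP u)) // !mul0r.
  (* In the interior both extensions agree with [u], so their difference [g] vanishes. *)
  suff -> : g x = 0 by rewrite mulr0 mul0r.
  pose y : interior B := Sub x xB.
  have /ffunP/(_ (val y)) := fg; rewrite [RHS]ffunE.
  rewrite zero_ext_int (neumann_ext_int (neumann_extP u)).
  by move=> /esym/eqP; rewrite -subr_eq0 addrC addKr => /eqP.
(* Of the two cross terms in the energy of [f + g], one is [cross] and the other reduces to it by
   symmetry of the Laplacian. *)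
rewrite fg linearD /= innerDl !innerDr cross addr0 [X in _ + (X + _)]innerC.
by rewrite -laplacian_sym cross add0r lerDl energy_ge0.
Qed.

End Energy.

Theorem theorem1p5 (R : realType) (G : weightedGraph R) (B : {set G})
    (B_neq0 : B != set0)
    (lambda nu : #|{: interior B}|.-tuple R)
    (lambdaP : eigenvalues_of (linfun (@dirichlet_laplacian R G B)) lambda)
    (nuP : eigenvalues_of (linfun (@neumann_laplacian R G B)) nu)
    (i : 'I_#|{: interior B}|) :
  tnth lambda i >= tnth nu i.
Proof.
apply: (eigenvalues_le (fun x => mass_gt0 (val x))
  (@neumann_laplacian_sym R G B)
  (@dirichlet_laplacian_sym R G B) (@neumann_form_le R G B) nuP lambdaP).
Qed.
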